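(* Let $R$ be a commutative noetherian ring admitting a dualizing complex and let $G$ be a Gorenstein injective $R$-module. Then $G\cong E\oplus H$ where $E$ is injective and $H$ is a reduced Gorenstein injective $R$-module.
   Context: A dualizing complex for $R$ is a complex $D$ with bounded, finitely generated homology and finite injective dimension such that the homothety morphism $R\to\mathbf{R}\mathrm{Hom}_R(D,D)$ is an isomorphism in the derived category. An $R$-module $G$ is Gorenstein injective if there is an exact sequence $\mathcal I:\dots\to E_1\to E_0\to E_{-1}\to\dots$ of injective $R$-modules such that $\operatorname{Hom}_R(E,\mathcal I)$ is exact for every injective $R$-module $E$ and $G=\operatorname{Ker}(E_0\to E_{-1})$. A module is reduced if it has no non-zero injective submodule. *)

(* Defs.v *)
From HB Require Import structures.
From mathcomp Require Import all_boot all_order all_algebra.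
From mathcomp Require Import boolp zify.
Set Implicit Arguments.
Unset Strict Implicit.
Unset Printing Implicit Defensive.
Import GRing.Theory.
Local Open Scope ring_scope.

(* Base rings range over comPzRingType, so the zero ring is allowed. *)

Section Modules.
Variable R : comPzRingType.

(* Every ideal is generated by finitely many of its elements. *)
Definition noetherian : Prop :=
  forall I : {pred R^o}, submod_closed I ->
  exists (n : nat) (g : 'I_n -> R),
    (forall i, g i \in I) /\
    (forall x, x \in I -> exists c : 'I_n -> R, x = \sum_(i < n) c i * g i).

Definition injective_module (E : lmodType R) : Prop :=
  forall (A B : lmodType R) (f : {linear A -> B}) (g : {linear A -> E}),
    injective f -> exists h : {linear B -> E}, forall x, h (f x) = g x.

(* Submodules of M are represented by injective linear maps into M. *)
Definition reduced_module (M : lmodType R) : Prop :=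
  forall (E : lmodType R) (f : {linear E -> M}),
    injective_module E -> injective f -> forall x : E, x = 0.

Definition isomorphic_module (M N : lmodType R) : Prop :=
  exists f : {linear M -> N}, bijective f.

End Modules.

(* Complexes are graded homologically by int. The differential is given between *)
(* all pairs of degrees, and vanishes unless it goes from degree j + 1 to j;    *)
(* this avoids transports between the types C (i + 1 - 1) and C i.              *)
Record complex (R : comPzRingType) := Complex {
  cobj :> int -> lmodType R;
  cdiff : forall i j : int, {linear cobj i -> cobj j};
  cdiff_shape : forall i j : int, i != j + 1 -> forall x, cdiff i j x = 0;
  cdiffK : forall (i j k : int) x, cdiff j k (cdiff i j x) = 0 }.

Record chain_map (R : comPzRingType) (C D : complex R) := ChainMap {
  cmap :> forall i : int, {linear C i -> D i};
  cmap_diff : forall (i j : int) x,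
    cdiff D i j (cmap i x) = cmap j (cdiff C i j x) }.

Section Homology.
Variable R : comPzRingType.
Implicit Types C D : complex R.

Definition is_cycle C (i : int) (x : C i) : Prop := cdiff C i (i - 1) x = 0.

Definition is_boundary C (i : int) (x : C i) : Prop :=
  exists y : C (i + 1), cdiff C (i + 1) i y = x.

Definition acyclic C : Prop :=
  forall (i : int) (x : C i), is_cycle x -> is_boundary x.

(* The induced map on homology, [x] |-> [f x], is injective and surjective in *)
(* every degree.                                                              *)
Definition quasi_iso C D (f : chain_map C D) : Prop :=
  forall i : int,
    (forall x : C i, is_cycle x -> is_boundary (f i x) -> is_boundary x) /\
    (forall y : D i, is_cycle y ->
       exists x : C i, is_cycle x /\ is_boundary (y - f i x)).

Definition bounded C : Prop :=
  exists N : nat, forall i : int, (N < `|i|)%N -> forall x : C i, x = 0.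

Definition bounded_homology C : Prop :=
  exists N : nat, forall i : int, (N < `|i|)%N ->
    forall x : C i, is_cycle x -> is_boundary x.

Definition fg_homology C : Prop :=
  forall i : int, exists (n : nat) (z : 'I_n -> C i),
    (forall k, is_cycle (z k)) /\
    (forall x : C i, is_cycle x ->
       exists c : 'I_n -> R, is_boundary (x - \sum_(k < n) c k *: z k)).

Definition injective_terms C : Prop := forall i : int, injective_module (C i).

End Homology.

(* The module of degree n maps: the product over i of Hom (C i, D (i + n)). *)
Definition cochain (R : comPzRingType) (C D : complex R) (n : int) : Type :=
  forall i j : int, j = i + n -> {linear C i -> D j}.

Section HomComplex.
Variables (R : comPzRingType) (C D : complex R).

Lemma linear_ext (U V : lmodType R) (f g : {linear U -> V}) : f =1 g -> f = g.
Proof.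
case: f g => [f [[a] [b] ]] [g [[a'] [b'] ]] /= /funext fg.
case: _ / fg a' b' => a' b'.
by rewrite (Prop_irrelevance a a') (Prop_irrelevance b b').
Qed.

Section Module.
Variable n : int.
Implicit Types f g h : cochain C D n.

HB.instance Definition _ := gen_eqMixin (cochain C D n).
HB.instance Definition _ := gen_choiceMixin (cochain C D n).

Lemma cochain_ext f g : (forall i j e x, f i j e x = g i j e x) -> f = g.
Proof.
move=> fg; apply: functional_extensionality_dep => i.
apply: functional_extensionality_dep => j.
apply: functional_extensionality_dep => e.
by apply: linear_ext => x; apply: fg.
Qed.

Definition cochain0 : cochain C D n := fun i j _ => \0 : {linear C i -> D j}.
Definition cochainN f : cochain C D n :=
  fun i j e => (\- f i j e : {linear C i -> D j}).
Definition cochainD f g : cochain C D n :=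
  fun i j e => (f i j e \+ g i j e : {linear C i -> D j}).
Definition cochainZ (a : R) f : cochain C D n :=
  fun i j e => (a \*: f i j e : {linear C i -> D j}).

Lemma cochainDA : associative cochainD.
Proof. by move=> f g h; apply: cochain_ext => i j e x /=; rewrite addrA. Qed.
Lemma cochainDC : commutative cochainD.
Proof. by move=> f g; apply: cochain_ext => i j e x /=; rewrite addrC. Qed.
Lemma cochain0D : left_id cochain0 cochainD.
Proof. by move=> f; apply: cochain_ext => i j e x /=; rewrite add0r. Qed.
Lemma cochainND : left_inverse cochain0 cochainN cochainD.
Proof. by move=> f; apply: cochain_ext => i j e x /=; rewrite addNr. Qed.

HB.instance Definition _ := GRing.isZmodule.Build (cochain C D n)
  cochainDA cochainDC cochain0D cochainND.

Lemma cochainZA a b f : cochainZ a (cochainZ b f) = cochainZ (a * b) f.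
Proof. by apply: cochain_ext => i j e x /=; rewrite scalerA. Qed.
Lemma cochain1Z : left_id 1 cochainZ.
Proof. by move=> f; apply: cochain_ext => i j e x /=; rewrite scale1r. Qed.
Lemma cochainZDr : right_distributive cochainZ +%R.
Proof. by move=> a f g; apply: cochain_ext => i j e x /=; rewrite scalerDr. Qed.
Lemma cochainZDl f : {morph cochainZ^~ f : a b / a + b}.
Proof. by move=> a b; apply: cochain_ext => i j e x /=; rewrite scalerDl. Qed.

HB.instance Definition _ := GRing.Zmodule_isLmodule.Build R (cochain C D n)
  cochainZA cochain1Z cochainZDr cochainZDl.

End Module.

Fact hom_index (i j n m : int) : j = i + m -> j = (i + m - n) + n.
Proof. by move=> ->; rewrite subrK. Qed.

(* d f = d_D \o f - (-1)^n f \o d_C for f of degree n. No condition on m is     *)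
(* needed: both summands vanish unless n = m + 1, by the shape of d_C and d_D.  *)
Definition hom_diff_fun (n m : int) (f : cochain C D n) : cochain C D m :=
  fun i j e =>
    ((cdiff D (i + n) j \o f i (i + n) erefl) \-
     ((-1) ^+ `|n|%N \*:
        (f (i + m - n) j (hom_index n e) \o cdiff C i (i + m - n)))
     : {linear C i -> D j}).

Lemma hom_diff_fun_linear n m : linear (@hom_diff_fun n m).
Proof.
move=> a f g; apply: cochain_ext => i j e x.
rewrite /hom_diff_fun /= linearP /= !scalerDr scalerN !scalerA.
by rewrite [a * _]mulrC opprD addrACA.
Qed.

HB.instance Definition _ (n m : int) :=
  GRing.isLinear.Build R (cochain C D n) (cochain C D m) *:%R
    (@hom_diff_fun n m) (@hom_diff_fun_linear n m).

Definition hom_diff (n m : int) : {linear cochain C D n -> cochain C D m} :=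
  @hom_diff_fun n m.

Lemma hom_diff_shape (n m : int) :
  n != m + 1 -> forall f, hom_diff n m f = 0.
Proof.
move=> nm f; apply: cochain_ext => i j e x /=.
rewrite cdiff_shape; last by move: nm e; clear; lia.
rewrite (@cdiff_shape _ C) ?linear0 ?scaler0 ?oppr0 ?addr0 //.
by move: nm; clear; lia.
Qed.

Fact hom_diffK_transport (n : int) (f : cochain C D n) (h l i i' j j' : int)
    (e : j = i + n) (e' : j' = i' + n) (x : C h) : i = i' ->
  cdiff D j l (f i j e (cdiff C h i x)) =
  cdiff D j' l (f i' j' e' (cdiff C h i' x)).
Proof.
by move=> ii; subst i' j j'.
Qed.

Lemma hom_diffK (n m k : int) (f : cochain C D n) :
  hom_diff m k (hom_diff n m f) = 0.
Proof.
have [nm|] := eqVneq n (m + 1); last first.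
  by move=> /hom_diff_shape ->; rewrite linear0.
have [mk|] := eqVneq m (k + 1); last by move=> /hom_diff_shape ->.
apply: cochain_ext => i j e x /=.
rewrite linearB linearZ /= !cdiffK sub0r linear0 scaler0 subr0.
rewrite (@hom_diffK_transport n f i j (i + m - n) (i + k - m) _ _
  (hom_index n erefl) erefl x); last by move: nm mk; clear; lia.
rewrite -scaleNr -scaleNr -scalerDl.
have -> : (-1) ^+ `|n|%N = - (-1) ^+ `|m|%N :> R.
  have : odd `|n|%N = ~~ odd `|m|%N by move: nm; clear; lia.
  by rewrite -signr_odd => ->; rewrite signrN signr_odd.
by rewrite opprK subrr scale0r.
Qed.

Definition hom_complex : complex R :=
  @Complex R (fun n => cochain C D n) hom_diff hom_diff_shape hom_diffK.

End HomComplex.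

Section Stalk.
Variables (R : comPzRingType) (M : lmodType R).

Definition stalk_obj (i : int) : lmodType R :=
  if i is Posz 0 then M else 'rV[R]_0.

Definition stalk : complex R :=
  @Complex R stalk_obj (fun i j => \0 : {linear stalk_obj i -> stalk_obj j})
    (fun _ _ _ _ => erefl) (fun _ _ _ _ => erefl).

End Stalk.

Section RHom.
Variable R : comPzRingType.
Implicit Types D I : complex R.

(* Degreewise injective and K-injective. *)
Definition semi_injective I : Prop :=
  injective_terms I /\
  (forall A : complex R, acyclic A -> acyclic (hom_complex A I)).

(* A bounded complex of injectives is K-injective, so being isomorphic to it in *)
(* the derived category amounts to having a quasi-isomorphism to it.            *)
Definition finite_injective_dimension D : Prop :=
  exists (I : complex R) (f : chain_map D I),
    injective_terms I /\ bounded I /\ quasi_iso f.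

Section Homothety.
Variables (D I : complex R) (f : chain_map D I).

(* The chain map f as a degree 0 element of the Hom complex. *)
Definition cochain_of_map : cochain D I 0 := fun i j e =>
  ecast k {linear D i -> I k} (esym (etrans e (addr0 i))) (f i).

Lemma cochain_of_map_cycle (m : int) : hom_diff D I 0 m cochain_of_map = 0.
Proof.
have fl i j l (e : i = j) x :
    cdiff I j l (ecast k {linear D i -> I k} e (f i) x) = cdiff I i l (f i x).
  by case: j / e.
have fr h i j (e : i = j) x :
    ecast k {linear D i -> I k} e (f i) (cdiff D h i x) = cdiff I h j (f h x).
  by case: j / e; rewrite cmap_diff.
by apply: cochain_ext => i j e x /=; rewrite /cochain_of_map fl fr scale1r subrr.
Qed.

Definition homothety0_fun (r : R^o) : cochain D I 0 :=
  (r : R) *: cochain_of_map.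

Lemma homothety0_linear : linear homothety0_fun.
Proof. by move=> a r s; rewrite /homothety0_fun scalerDl scalerA. Qed.

HB.instance Definition _ :=
  GRing.isLinear.Build R R^o (cochain D I 0) *:%R
    homothety0_fun homothety0_linear.

Definition homothety_fun (i : int) :
    {linear stalk R^o i -> hom_complex D I i} :=
  match i return {linear stalk_obj R^o i -> cochain D I i} with
  | Posz 0 => homothety0_fun
  | Posz n.+1 => \0
  | Negz n => \0
  end.

Lemma homothety_diff (i j : int) x :
  cdiff (hom_complex D I) i j (homothety_fun i x) =
  homothety_fun j (cdiff (stalk R^o) i j x).
Proof.
rewrite [RHS]linear0; case: i x => [[|n]|n] x; rewrite [LHS]/=.
- by rewrite linearZ /= cochain_of_map_cycle scaler0.
- by rewrite linear0.
- by rewrite linear0.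
Qed.

(* R -> Hom (D, I), r |-> r f. When f is a semi-injective resolution of D, the  *)
(* target is RHom (D, D) and this is the homothety morphism; up to isomorphism  *)
(* in the derived category it does not depend on the choice of f.               *)
Definition homothety : chain_map (stalk R^o) (hom_complex D I) :=
  ChainMap homothety_diff.

End Homothety.

Record dualizing_complex D : Prop := DualizingComplex {
  dualizing_bounded : bounded_homology D;
  dualizing_fg : fg_homology D;
  dualizing_injdim : finite_injective_dimension D;
  dualizing_homothety :
    exists (I : complex R) (f : chain_map D I),
      semi_injective I /\ quasi_iso f /\ quasi_iso (homothety f) }.

Definition admits_dualizing_complex : Prop :=
  exists D : complex R, dualizing_complex D.

End RHom.

Section GorensteinInjective.
Variable R : comPzRingType.

(* The complex Hom (E, C) is exact. *)
Definition hom_from_exact (E : lmodType R) (C : complex R) : Prop :=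
  forall (i : int) (g : {linear E -> C i}),
    (forall x, cdiff C i (i - 1) (g x) = 0) ->
    exists h : {linear E -> C (i + 1)},
      forall x, cdiff C (i + 1) i (h x) = g x.

Definition gorenstein_injective (G : lmodType R) : Prop :=
  exists C : complex R,
    [/\ injective_terms C,
        acyclic C,
        forall E : lmodType R, injective_module E -> hom_from_exact E C &
        exists k : {linear G -> C 0},
          injective k /\ (forall y : C 0, is_cycle y <-> exists x, k x = y)].

End GorensteinInjective.

(* Main.v *)
(* Over a noetherian ring, Baer's criterion shows that the union of a chain of *)
(* injective submodules is injective, so by Zorn G has a maximal injective    *)
(* submodule E. It splits off, G = E + H, and H is reduced by maximality. Let C *)
(* be a complex witnessing that G is Gorenstein injective. To replace G by H, *)
(* add E to C in degree -1, to kill E inside C_0, and in degree 2, to kill the *)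
(* preimage of E in C_1: as Hom (E, C) is exact, the inclusion of E in C_0    *)
(* factors through C_1, and this provides the new map from E to C_1. The      *)
(* exactness of the new complex under Hom (A, -) only uses that of C for the  *)
(* same A; for A = R this is acyclicity.                                      *)

Require Import Defs.
From HB Require Import structures.
From mathcomp Require Import all_boot all_order all_algebra.
From mathcomp Require Import boolp classical_sets zify.
Set Implicit Arguments.
Unset Strict Implicit.
Unset Printing Implicit Defensive.
Import GRing.Theory.
Local Open Scope classical_set_scope.
Local Open Scope ring_scope.

(** Injectivity of a submodule is expressed by Baer's condition [baer] on subsets of the ambient
    module ([injective_baer], [baer_injective]), so that Zorn's lemma can run over subsets;
    [baer_bigcup] handles chains and [max_injective_submodule] yields $E$. The cycles of
    [ks_complex] in degree 0 form $\ker d \cap \ker r$, where $r$ extends the projection $G \to E$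
    to $C_0$; this kernel is $H$. [ks_hom_exact] carries exactness over to the new complex. *)

(** [Zorn_bigcup] also asks for the union of the empty chain, so the empty set is adjoined to [P];
    if it comes out maximal, it equals [A0]. *)
Lemma Zorn_bigcup_nonempty (T : Type) (P : set (set T)) (A0 : set T) :
  P A0 ->
  (forall F : set (set T), F !=set0 -> F `<=` P -> total_on F subset ->
     P (\bigcup_(X in F) X)) ->
  exists A, P A /\ forall B, A `<=` B -> P B -> B `<=` A.
Proof.
move=> PA0 chainP.
have [|A [PA maxA]] := @Zorn_bigcup T [set X | X = set0 \/ P X].
  move=> F FP totF /=.
  have [[X [FX PX]]|noP] := pselect (exists X, F X /\ P X); last first.
    left; rewrite -subset0 => x [X FX Xx].
    by have [X0|PX] := FP _ FX; [rewrite -X0 | case: noP; exists X].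
  right; have -> : \bigcup_(X in F) X = \bigcup_(X in F `&` P) X.
    apply/seteqP; split=> x [Y]; last by case=> FY _ Yx; exists Y.
    move=> FY Yx; exists Y => //; split=> //.
    by have [Y0|] := FP _ FY; first by move: Yx; rewrite Y0.
  apply: chainP; first by exists X.
    by move=> Y [].
  by move=> Y Z [FY _] [FZ _]; exact: totF.
have {}maxA B : A `<=` B -> P B -> B `<=` A.
  move=> AB PB; apply: contrapT => nBA.
  by apply: (maxA B); [split | right].
exists A; split=> //; case: PA => // A00; move: maxA; rewrite A00 => maxA.
by have <- : A0 = set0 by rewrite -subset0; apply: maxA PA0.
Qed.

(** * Submodules, Baer's criterion and maximal injective submodules *)

Section Submodules.
Variable R : comPzRingType.

Definition linear_of (M N : lmodType R) (f : M -> N) (f_lin : linear f) :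
    {linear M -> N} :=
  HB.pack f (GRing.isLinear.Build R M N *:%R f f_lin).

Definition submod (M : lmodType R) (S : set M) : Prop :=
  S 0 /\ forall a x y, S x -> S y -> S (a *: x + y).

Lemma submodD (M : lmodType R) (S : set M) x y :
  submod S -> S x -> S y -> S (x + y).
Proof. by move=> [_ SP] Sx Sy; rewrite -[x]scale1r; apply: SP. Qed.

Lemma submodZ (M : lmodType R) (S : set M) a x : submod S -> S x -> S (a *: x).
Proof. by move=> [S0 SP] Sx; rewrite -[_ *: _]addr0; apply: SP. Qed.

Lemma submodB (M : lmodType R) (S : set M) x y :
  submod S -> S x -> S y -> S (x - y).
Proof.
by move=> Ssub Sx Sy; rewrite -scaleN1r; apply: submodD => //; apply: submodZ.
Qed.

Lemma submod_sum (M : lmodType R) (S : set M) n (x : 'I_n -> M) :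
  submod S -> (forall i, S (x i)) -> S (\sum_(i < n) x i).
Proof.
by move=> Ssub Sx; elim/big_rec: _ => [|i y _]; [case: Ssub | apply: submodD].
Qed.

Lemma submod_bigcup (M : lmodType R) (F : set (set M)) :
  F !=set0 -> (forall S, F S -> submod S) -> total_on F subset ->
  submod (\bigcup_(S in F) S).
Proof.
move=> [S0 FS0] Fsub totF; split.
  by exists S0 => //; have [] := Fsub _ FS0.
move=> a x y [S FS Sx] [T FT Ty]; have [ST|TS] := totF _ _ FS FT.
  by exists T => //; apply: (Fsub _ FT).2 => //; apply: ST.
by exists S => //; apply: (Fsub _ FS).2 => //; apply: TS.
Qed.

Lemma submod_range (M N : lmodType R) (f : {linear M -> N}) : submod (range f).
Proof.
split; first by exists 0; rewrite ?linear0.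
by move=> a _ _ [x _ <-] [y _ <-]; exists (a *: x + y); rewrite ?linearP.
Qed.

Section Inclusion.
Variables (M : lmodType R) (S : set M).
Hypothesis S_sub : submod S.

Let S_pred : {pred M} := [pred x | `[< S x >]].

Let S_closed : submod_closed S_pred.
Proof.
split; first by apply/asboolP; case: S_sub.
by move=> a x y /asboolP Sx /asboolP Sy; apply/asboolP; apply S_sub.2.
Qed.

HB.instance Definition _ := GRing.isSubmodClosed.Build R M S_pred S_closed.

Definition submod_type : Type := {x | x \in S_pred}.
HB.instance Definition _ := SubChoice.on submod_type.
HB.instance Definition _ := [SubChoice_isSubLmodule of submod_type by <:].

Lemma submod_incl :
  exists (E : lmodType R) (i : {linear E -> M}), injective i /\ range i = S.
Proof.
exists submod_type, (\val : {linear submod_type -> M}).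
split; first exact: val_inj.
apply/seteqP; split=> [_ [x _ <-]|x Sx].
  by have /asboolP := valP x.
have Sx' : x \in S_pred by apply/asboolP.
by exists (Sub x Sx').
Qed.

End Inclusion.

(* A submodule of M * N meeting 0 * N trivially is the graph of a linear map  *)
(* from its projection to M.                                                  *)
Definition functional (M N : lmodType R) (T : set (M * N)%type) : Prop :=
  forall y, T (0, y) -> y = 0.

Lemma functional_eq (M N : lmodType R) (T : set (M * N)%type) x y y' :
  submod T -> functional T -> T (x, y) -> T (x, y') -> y = y'.
Proof.
move=> Tsub Tfun Ty Ty'; apply/eqP; rewrite -subr_eq0; apply/eqP/Tfun.
by rewrite -(subrr x); apply: (submodB Tsub Ty Ty').
Qed.

(* Baer's criterion for the submodule S, a map from an ideal of R to S being  *)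
(* given by its graph T.                                                      *)
Definition baer (M : lmodType R) (S : set M) : Prop :=
  forall T : set (R^o * M)%type, submod T -> functional T ->
  (forall u, T u -> S u.2) -> exists2 y, S y & forall u, T u -> u.2 = u.1 *: y.

Lemma functional_linear (M N : lmodType R) (T : set (M * N)%type) :
  submod T -> functional T -> (forall x, exists y, T (x, y)) ->
  exists h : {linear M -> N}, forall u, T u -> h u.1 = u.2.
Proof.
move=> Tsub Tfun /choice[h Th].
have h_lin : linear h.
  move=> a x y; apply: (functional_eq Tsub Tfun (Th _)).
  by rewrite -[(_, _)]/(a *: (x, h x) + (y, h y)); apply Tsub.2.
exists (linear_of h_lin) => -[x y] Txy /=.
exact: (functional_eq Tsub Tfun (Th x)).
Qed.

Lemma injective_baer (M E : lmodType R) (m : {linear E -> M}) :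
  injective_module E -> injective m -> baer (range m).
Proof.
move=> Einj m_inj T Tsub Tfun Tm.
(* Pull the graph back to [R * E]. Its first projection is injective as [T] is functional, so its
   second projection extends to [h] on [R], and [m (h 1)] is the multiplier. *)
have T'sub : submod [set v : R^o * E | T (v.1, m v.2)].
  split=> [|a x y /= Tx Ty]; first by rewrite /= linear0; case: Tsub.
  rewrite linearP.
  exact: (Tsub.2 a (x.1, m x.2) (y.1, m y.2)).
have [D [i [i_inj i_range]]] := submod_incl T'sub.
have Ti z : T ((i z).1, m (i z).2).
  by have : range i (i z); [exists z | rewrite i_range].
have p1_lin : linear (fun z => (i z).1) by move=> a x y; rewrite linearP.
have p2_lin : linear (fun z => (i z).2) by move=> a x y; rewrite linearP.
have [|h hP] := Einj _ _ (linear_of p1_lin) (linear_of p2_lin).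
  move=> x y /= xy; apply: i_inj; have := Ti y; have := Ti x; move: xy.
  case: (i x) (i y) => [a b] [_ c] /= <- Tb Tc.
  by rewrite (m_inj _ _ (functional_eq Tsub Tfun Tb Tc)).
exists (m (h 1)); first by exists (h 1).
move=> [r y] Try /=; have [e _ /= me] := Tm _ Try.
have /= [z _ iz] : range i (r, e) by rewrite i_range /= me.
have := hP z; rewrite /= iz /= -me => <-.
by rewrite -!linearZ /GRing.scale /= mulr1.
Qed.

(** Baer's condition for the ideal of those [r] with [r *: b] in the domain of [Gam]: [d] is a
    consistent value at [b] for an extension of the partial map. *)
Lemma baer_extend (M D B : lmodType R) (i : {linear D -> M})
    (Gam : set (B * D)%type) (b : B) :
  baer (range i) -> injective i -> submod Gam -> functional Gam ->
  exists d, forall r y, Gam (r *: b, y) -> y = r *: d.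
Proof.
move=> iB i_inj Gsub Gfun.
pose T := [set u : R^o * M | exists2 y, i y = u.2 & Gam ((u.1 : R) *: b, y)].
have [|||_ [d _ <-] dP] := iB T.
- split=> [|a [r _] [s _] [y /= <- Gy] [z /= <- Gz]].
    by exists 0; rewrite /= ?linear0 ?scale0r //; case: Gsub.
  exists (a *: y + z); rewrite /= ?linearP // scalerDl -scalerA.
  by have := Gsub.2 a _ _ Gy Gz.
- by move=> _ [y /= <-]; rewrite scale0r => /Gfun ->; rewrite linear0.
- by move=> u [y iy _]; exists y.
exists d => r y Gy; apply: i_inj; rewrite linearZ.
by apply: (dP (r, i y)); exists y.
Qed.

Lemma baer_injective (M D : lmodType R) (i : {linear D -> M}) :
  baer (range i) -> injective i -> injective_module D.
Proof.
move=> iB i_inj A B f g f_inj.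
pose P := [set Gam : set (B * D)%type |
  [/\ submod Gam, functional Gam & forall a, Gam (f a, g a)]].
have fg_lin : linear (fun a => (f a, g a) : (B * D)%type).
  by move=> a x y; rewrite !linearP.
have [|F Fne FP totF|Gam [[Gsub Gfun Gfg] maxG]] :=
    @Zorn_bigcup_nonempty _ P (range (linear_of fg_lin)).
- split; first exact: submod_range.
    by move=> _ [a _ [/= fa0 <-]]; rewrite (f_inj a 0) ?linear0.
  by move=> a; exists a.
- split.
  + by apply: submod_bigcup => // S /FP[].
  + by move=> y [S /FP[_ Sfun _] /Sfun].
  + by move=> a; case: Fne => S FS; exists S => //; have [] := FP _ FS.
have [|h hP] := functional_linear Gsub Gfun; last first.
  by exists h => a; apply: (hP (f a, g a)).
(* A maximal graph is total: adjoining the multiples of [(b, d)] keeps it functional by [dP], so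
   they already lie in it. *)
move=> b; have [d dP] := baer_extend b iB i_inj Gsub Gfun; exists d.
pose Gam' := [set u : B * D | exists r v, Gam v /\ u = v + r *: (b, d)].
apply: (maxG Gam').
- by move=> u Gu; exists 0, u; rewrite scale0r addr0.
- split.
  + split=> [|a _ _ [r [u [Gu ->]]] [s [v [Gv ->]]]].
      by exists 0, 0; rewrite scale0r addr0; split=> //; case: Gsub.
    exists (a * r + s), (a *: u + v); split; first exact: Gsub.2.
    by rewrite scalerDr scalerDl scalerA addrACA.
  + move=> y [r [[x z] [Gxz [/esym/eqP]]]].
    rewrite addr_eq0 => /eqP xrb ->; apply/eqP; rewrite addr_eq0; apply/eqP.
    apply/oppr_inj; rewrite opprK; apply: dP.
    have -> : r *: b = - x by rewrite xrb opprK.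
    by have := submodZ (-1) Gsub Gxz; rewrite scaleN1r.
  + by move=> a; exists 0, (f a, g a); rewrite scale0r addr0.
- exists 1, 0; rewrite scale1r add0r; split=> //; by case: Gsub.
Qed.

Lemma injective_prod (E F : lmodType R) :
  injective_module E -> injective_module F -> injective_module (E * F)%type.
Proof.
move=> Einj Finj A B f g f_inj.
have p1_lin : linear (fun z => (g z).1) by move=> a x y; rewrite linearP.
have p2_lin : linear (fun z => (g z).2) by move=> a x y; rewrite linearP.
have [h1 h1P] := Einj _ _ f (linear_of p1_lin) f_inj.
have [h2 h2P] := Finj _ _ f (linear_of p2_lin) f_inj.
have h_lin : linear (fun b => (h1 b, h2 b) : (E * F)%type).
  by move=> a x y; rewrite !linearP.
by exists (linear_of h_lin) => x; rewrite /= h1P h2P /=; case: (g x).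
Qed.

Lemma injective_zero : injective_module 'rV[R]_0.
Proof. by move=> A B f g _; exists \0 => x; rewrite [RHS]thinmx0. Qed.

Lemma chain_finite_mem (T : Type) (F : set (set T)) n (x : 'I_n -> T) :
  F !=set0 -> total_on F subset -> (forall i, (\bigcup_(S in F) S) (x i)) ->
  exists2 S, F S & forall i, S (x i).
Proof.
move=> [S0 FS0] totF; elim: n x => [|n IHn] x xF; first by exists S0 => // -[].
have [S FS Sx] := IHn (x \o lift ord0) (fun i => xF (lift ord0 i)).
have [S' FS' S'x] := xF ord0.
have [SS'|S'S] := totF _ _ FS FS'; [exists S' | exists S] => // i.
  by have [j ->|->] := unliftP ord0 i => //; apply: SS' (Sx j).
by have [j ->|->] := unliftP ord0 i; [apply: Sx j | apply: S'S].
Qed.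

(** The domain of [T] is a finitely generated ideal; the values at its generators lie in one member
    of the chain, hence so do all values, and that member's condition applies. *)
Lemma baer_bigcup (M : lmodType R) (F : set (set M)) :
  noetherian R -> F !=set0 -> total_on F subset ->
  (forall S, F S -> submod S /\ baer S) -> baer (\bigcup_(S in F) S).
Proof.
move=> noethR Fne totF FP T Tsub Tfun TF.
pose I : {pred R^o} := [pred r | `[< exists y, T (r, y) >]].
have [|n [r [rI genI]]] := noethR I.
  split; first by apply/asboolP; exists 0; case: Tsub.
  move=> a x y /asboolP[x' Tx] /asboolP[y' Ty]; apply/asboolP.
  by exists (a *: x' + y'); have := Tsub.2 a _ _ Tx Ty.
have {}rI i : exists y, T (r i, y) by apply/asboolP/rI.
have {rI}[y Ty] := choice rI.
have [S FS Sy] := chain_finite_mem Fne totF (fun i => TF _ (Ty i)).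
have [Ssub SB] := FP _ FS.
have [|z Sz zP] := SB T Tsub Tfun; last by exists z => //; exists S.
move=> [s x] Tsx; have [|c sc] := genI s; first by apply/asboolP; exists x.
rewrite /= (functional_eq Tsub Tfun Tsx (y' := \sum_i c i *: y i)).
  by apply: submod_sum => // i; apply: (submodZ _ Ssub (Sy i)).
suff -> : (s, \sum_i c i *: y i) = \sum_i c i *: ((r i, y i) : R^o * M).
  by apply: submod_sum => // i; apply: submodZ.
rewrite sc; apply: (big_ind3 (fun p q w => (p, q) = w)) => //.
by move=> ? ? ? ? ? ? <- <-.
Qed.

Lemma max_injective_submodule (M : lmodType R) :
  noetherian R ->
  exists (E : lmodType R) (i : {linear E -> M}),
    [/\ injective_module E, injective i &
      forall (E' : lmodType R) (j : {linear E' -> M}), injective_module E' ->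
        injective j -> range i `<=` range j -> range j `<=` range i].
Proof.
move=> noethR.
have [|F Fne FP totF|S [[Ssub SB] maxS]] :=
    @Zorn_bigcup_nonempty M [set S | submod S /\ baer S] [set 0].
- split; first by split=> // a _ _ -> ->; rewrite scaler0 addr0.
  by move=> T Tsub Tfun T0; exists 0 => // u /T0 /= ->; rewrite scaler0.
- split; last exact: baer_bigcup.
  by apply: submod_bigcup => // S /FP[].
have [E [i [i_inj iS]]] := submod_incl Ssub.
exists E, i; split=> //; first by apply: baer_injective i_inj; rewrite iS.
move=> E' j E'inj j_inj; rewrite iS => Sj; apply: maxS => //.
by split; [apply: submod_range | apply: injective_baer].
Qed.

End Submodules.

(** * Removing a summand from the degree 0 cycles of a complex *)

Section KillSummand.
Variables (R : comPzRingType) (C : complex R) (E : lmodType R).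
Variables (k : {linear E -> C 0}) (r : {linear C 0 -> E}).
Variable s : {linear E -> C 1}.
Hypothesis rk : cancel k r.
Hypothesis dk : forall e, cdiff C 0 (- 1) (k e) = 0.
Hypothesis ds : forall e, cdiff C 1 0 (s e) = k e.

(* ... -> C 3 -> C 2 * E -> C 1 -> C 0 -> C (-1) * E -> C (-2) -> ...         *)
(* with middle maps (x, e) |-> d x + s e, x |-> d x - k (r (d x)) and         *)
(* x |-> (d x, r x). The families below are zero outside the one degree where *)
(* they matter, which gives a uniform formula for the differential: ks_pr and *)
(* ks_in' identify the extra term of degree 2 with E, and ks_in and ks_pr' that *)
(* of degree -1.                                                              *)
Definition ks_extra (i : int) : lmodType R :=
  match i with Posz 2 | Negz 0 => E | _ => 'rV[R]_0 end.

Definition ks_obj (i : int) : lmodType R := (C i * ks_extra i)%type.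

Definition ks_k (i : int) : {linear E -> C i} :=
  match i with Posz 0 => k | _ => \0 end.

Definition ks_r (i : int) : {linear C i -> E} :=
  match i with Posz 0 => r | _ => \0 end.

Definition ks_s (i : int) : {linear E -> C i} :=
  match i with Posz 1 => s | _ => \0 end.

Definition ks_pr (i : int) : {linear ks_extra i -> E} :=
  match i with Posz 2 => idfun | _ => \0 end.

Definition ks_in (i : int) : {linear E -> ks_extra i} :=
  match i with Negz 0 => idfun | _ => \0 end.

Definition ks_diff_fun (i j : int) (u : ks_obj i) : ks_obj j :=
  (cdiff C i j u.1 - ks_k j (ks_r j (cdiff C i j u.1)) + ks_s j (ks_pr i u.2),
   ks_in j (ks_r i u.1)).

Lemma ks_diff_linear i j : linear (@ks_diff_fun i j).
Proof.
move=> a [x e] [y e']; apply: injective_projections => /=.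
  by rewrite !linearP !scalerDr /= [X in X + _ = _]addrACA [LHS]addrACA.
by rewrite (linearP (ks_r i)) (linearP (ks_in j)).
Qed.

Definition ks_diff i j : {linear ks_obj i -> ks_obj j} :=
  linear_of (@ks_diff_linear i j).

Lemma ks_diff_shape i j : i != j + 1 -> forall u, ks_diff i j u = 0.
Proof.
move=> ij u; rewrite /= /ks_diff_fun cdiff_shape // !linear0 addr0 add0r.
congr pair; move: i j ij u => [[|[|[|i]]]|i] [[|[|j]]|[|j]] //= _ u;
  by rewrite linear0.
Qed.

Lemma ks_rk i e : ks_r i (ks_k i e) = if i == 0 then e else 0.
Proof. by case: i => [[|i]|i] //=. Qed.

Lemma ks_dk i j e : cdiff C i j (ks_k i e) = 0.
Proof.
case: i => [[|i]|i]; rewrite ?linear0 //=.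
have [->|j1] := eqVneq j (- 1); first exact: dk.
by apply: cdiff_shape; move: j1; lia.
Qed.

Lemma ks_ds i j e : cdiff C i j (ks_s i e) = if i == 1 then ks_k j e else 0.
Proof.
case: i => [[|[|i]]|i] /=; rewrite ?linear0 //.
have [->|j0] := eqVneq j 0; first exact: ds.
rewrite cdiff_shape; last by move: j0; lia.
by case: j j0 => [[]|].
Qed.

Lemma ks_krk i e : ks_k i (ks_r i (ks_k i e)) = ks_k i e.
Proof. by case: i => [[|i]|i] //=; rewrite rk. Qed.

Lemma ks_rkr i x : ks_r i (ks_k i (ks_r i x)) = ks_r i x.
Proof. by case: i x => [[|i]|i] x //=; rewrite rk. Qed.

Lemma ks_rs i e : ks_r i (ks_s i e) = 0.
Proof. by case: i => [[|i]|i] //=; rewrite linear0. Qed.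

Lemma ks_pr_in i e : ks_pr i (ks_in i e) = 0.
Proof. by case: i => [[|[|[|i]]]|[|i]]. Qed.

Lemma ks_diffK i j l u : ks_diff j l (ks_diff i j u) = 0.
Proof.
case: u => x e; rewrite /= /ks_diff_fun /= ks_pr_in !linear0 addr0.
congr pair; last by rewrite linearD linearB ks_rkr subrr ks_rs addr0 linear0.
rewrite linearD linearB /= cdiffK ks_dk subrr add0r ks_ds.
by case: ifP => _; rewrite ?ks_krk ?subrr ?linear0 ?addr0.
Qed.

Definition ks_complex : complex R := Complex ks_diff_shape ks_diffK.

Definition ks_pr' (i : int) : {linear ks_extra i -> E} :=
  match i with Negz 0 => idfun | _ => \0 end.

Definition ks_in' (i : int) : {linear E -> ks_extra i} :=
  match i with Posz 2 => idfun | _ => \0 end.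

Lemma ks_in_r_eq0 i l (x : C i) :
  i = l + 1 -> ks_in l (ks_r i x) = 0 -> ks_r i x = 0.
Proof.
case: i x => [[|i]|i] x //.
by move=> il; have -> : l = - 1 by lia.
Qed.

Lemma ks_s_pr_in' i e : ks_s i (ks_pr (i + 1) (ks_in' (i + 1) e)) = ks_s i e.
Proof. by case: i => [[|[|i]]|i]. Qed.

Lemma ks_in_rk i e : ks_in i (ks_r (i + 1) (ks_k (i + 1) e)) = ks_in i e.
Proof. by case: i => [i|[|i]] //=; rewrite rk. Qed.

Lemma ks_in_pr' i x : ks_pr i x = 0 -> ks_in i (ks_pr' i x) = x.
Proof.
by case: i x => [[|[|[|i]]]|[|i]] x //=; first [move=> -> | rewrite [x]thinmx0].
Qed.

(** In degree 2, applying [d] to [d x + s e = 0] gives [k e = 0], and [k] is injective. *)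
Lemma ks_pr_cycle i x e : ks_diff i (i - 1) (x, e) = 0 -> ks_pr i e = 0.
Proof.
move=> -[/(congr1 (cdiff C (i - 1) 0)) + _] /=.
rewrite linearD linearB /= cdiffK ks_dk subrr add0r linear0 ks_ds.
case: eqP => [_ /(congr1 r)|i2 _]; first by rewrite /= rk linear0.
by case: i i2 x e => [[|[|[|i]]]|[|i]].
Qed.

Lemma ks_hom_exact (A : lmodType R) :
  hom_from_exact A C -> hom_from_exact A ks_complex.
Proof.
move=> exC i g g_cycle.
have g1_lin : linear (fun x => (g x).1) by move=> a x y; rewrite linearP.
have g2_lin : linear (fun x => (g x).2) by move=> a x y; rewrite linearP.
pose g1 : {linear A -> C i} := linear_of g1_lin.
pose g2 : {linear A -> ks_extra i} := linear_of g2_lin.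
have gE x : g x = (g1 x, g2 x) by rewrite /=; case: (g x).
have pr_g2 x : ks_pr i (g2 x) = 0.
  by apply: (@ks_pr_cycle _ (g1 x)); rewrite -gE; apply: g_cycle.
have [dg1 rg1] : (forall x, cdiff C i (i - 1) (g1 x) =
      ks_k (i - 1) (ks_r (i - 1) (cdiff C i (i - 1) (g1 x)))) /\
    (forall x, ks_r i (g1 x) = 0).
  split=> x; have := g_cycle x; rewrite gE => -[].
    by rewrite pr_g2 linear0 addr0 => /eqP; rewrite subr_eq0 => /eqP.
  by move=> _; apply: ks_in_r_eq0; rewrite subrK.
(* Nonzero only for [i = 1], where [d g1 = k t]; subtracting [s t] turns [g1] into a cycle of
   [C]. *)
pose t : {linear A -> E} := ks_r (i - 1) \o (cdiff C i (i - 1) \o g1).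
have [|h hP] := exC i (g1 \- (ks_s i \o t)).
  move=> x; rewrite /= linearB /= ks_ds; apply/eqP; rewrite subr_eq0; apply/eqP.
  rewrite [LHS]dg1; case: eqP => // i1.
  suff -> : ks_k (i - 1) = \0 by [].
  by case: i i1 {g g_cycle g1_lin g2_lin g1 g2 gE pr_g2 dg1 rg1 t}
    => [[|[|i]]|i] //.
(* For [i = -1], the term in [k] makes [r h1] equal to [g2] without changing [d h]. For [i = 1],
   [h2] restores the subtracted [s t]. *)
pose h1 : {linear A -> C (i + 1)} :=
  h \+ (ks_k (i + 1) \o ((ks_pr' i \o g2) \- (ks_r (i + 1) \o h))).
pose h2 : {linear A -> ks_extra (i + 1)} := ks_in' (i + 1) \o t.
have h_lin : linear (fun x => (h1 x, h2 x) : ks_obj (i + 1)).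
  by move=> a x y; rewrite (linearP h1) (linearP h2).
exists (linear_of h_lin) => x; rewrite gE; apply: injective_projections.
  rewrite [LHS]/= linearD ks_dk addr0 hP ks_s_pr_in' /= linearB rg1 ks_rs.
  by rewrite subrr linear0 subr0 subrK.
rewrite [LHS]/= linearD linearD ks_in_rk linearB /= addrC subrK.
exact: ks_in_pr' (pr_g2 x).
Qed.

End KillSummand.

(** * Complements of injective summands are Gorenstein injective *)

Section GorensteinInjectiveSummand.
Variable R : comPzRingType.

(** A linear map out of [R] is determined by its value at 1, which can be arbitrary. *)
Lemma acyclic_hom_exact (C : complex R) : acyclic C <-> hom_from_exact R^o C.
Proof.
have scale_lin (M : lmodType R) (x : M) : linear (fun a : R^o => (a : R) *: x).
  by move=> a b c; rewrite scalerDl -scalerA.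
split=> [exC i g g_cycle|exC i x x_cycle].
  have [y dy] := exC i (g 1) (g_cycle 1).
  exists (linear_of (scale_lin _ y)) => a /=; rewrite linearZ /= dy -linearZ.
  by rewrite /GRing.scale /= mulr1.
have [|h hP] := exC i (linear_of (scale_lin _ x)).
  by move=> a; rewrite /= linearZ /= [cdiff _ _ _ _]x_cycle scaler0.
by exists (h 1); rewrite hP /= scale1r.
Qed.

Lemma gorenstein_injective_summand (G E H : lmodType R)
    (u : {linear E -> G}) (p : {linear G -> E}) (v : {linear H -> G}) :
  gorenstein_injective G -> injective_module E -> cancel u p ->
  injective v -> (forall x, p x = 0 <-> exists y, v y = x) ->
  gorenstein_injective H.
Proof.
move=> [C [Cinj Cex Chom [kG [kG_inj kGP]]]] Einj uK v_inj vP.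
have [r rP] := Einj _ _ kG p kG_inj.
pose k : {linear E -> C 0} := kG \o u.
have rk : cancel k r by move=> e; rewrite /= rP uK.
have dk e : cdiff C 0 (- 1) (k e) = 0 by apply/kGP; exists (u e).
have [s ds] := Chom E Einj 0 k dk.
exists (ks_complex rk dk ds); split.
- move=> i; apply: injective_prod => //.
  by case: i => [[|[|[|i]]]|[|i]] //=; apply: injective_zero.
- by apply/acyclic_hom_exact/ks_hom_exact/acyclic_hom_exact.
- by move=> A Ainj; apply/ks_hom_exact/Chom.
have w_lin : linear (fun x => (kG (v x), 0) : ks_obj C E 0).
  move=> a x y; rewrite !linearP.
  by apply: injective_projections; rewrite //= scaler0 addr0.
exists (linear_of w_lin); split=> [x y [/kG_inj/v_inj]//|[y1 y2]].
split=> [[]|[x [<- _]]].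
  rewrite !linear0 !addr0 => /kGP[x <-] /=; rewrite rP => /vP[y <-].
  by exists y; congr pair; rewrite [RHS]thinmx0.
rewrite /is_cycle; apply: injective_projections.
  rewrite /= !linear0 !addr0.
  by apply/kGP; exists (v x).
by rewrite /= rP; apply/vP; exists x.
Qed.

End GorensteinInjectiveSummand.

(** * Splitting off a maximal injective submodule *)

Theorem proposition2p15 (R : comPzRingType) (G : lmodType R) :
  noetherian R ->
  admits_dualizing_complex R ->
  gorenstein_injective G ->
  exists E H : lmodType R,
    injective_module E /\
    (reduced_module H /\ gorenstein_injective H) /\
    isomorphic_module G (E * H)%type.
Proof.
move=> noethR _ Ggi.
have [E [u [Einj u_inj maxE]]] := max_injective_submodule G noethR.
have [p uK] : exists p : {linear G -> E}, cancel u p.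
  by have [p] := Einj _ _ u idfun u_inj; exists p.
have kerp_sub : submod [set x | p x = 0].
  split=> [|a x y /= px py]; first exact: linear0.
  by rewrite linearP px py scaler0 addr0.
have [H [v [v_inj v_range]]] := submod_incl kerp_sub.
have vP x : p x = 0 <-> exists y, v y = x.
  rewrite -[p x = 0]/([set x | p x = 0] x) -v_range.
  by split=> [[y _]|[y]]; exists y.
have pv y : p (v y) = 0 by apply/vP; exists y.
exists E, H; split=> //; split; first split.
- move=> F f Finj f_inj y.
  (* An injective [F] inside [H] makes [E * F] an injective submodule of [G] containing [E]. By
     maximality [v (f y)] lies in the image of [u]; as [p] kills it, it is 0. *)
  have m_lin : linear (fun z : (E * F)%type => u z.1 + v (f z.2)).
    by move=> a [e x] [e' x']; rewrite !linearP /= scalerDr addrACA.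
  have [||||e _ ue] := maxE _ (linear_of m_lin) _ _ _ (v (f y)).
  + exact: injective_prod.
  + move=> [e x] [e' x'] /= eq_m; have := congr1 p eq_m.
    rewrite !linearD !uK !pv !addr0 => ee'; move: eq_m; rewrite ee'.
    by move=> /addrI/v_inj/f_inj ->.
  + by move=> _ [e _ <-]; exists (e, 0) => //=; rewrite !linear0 addr0.
  + by exists (0, y) => //=; rewrite linear0 add0r.
  apply/f_inj/v_inj; rewrite !linear0 -ue.
  by rewrite -[e]uK ue pv linear0.
- exact: gorenstein_injective_summand Ggi Einj uK v_inj vP.
have vex x : exists y, v y = x - u (p x).
  by apply/vP; rewrite linearB uK subrr.
have [q qP] := choice vex.
have pq_lin : linear (fun x => (p x, q x) : (E * H)%type).
  move=> a x y; apply: injective_projections; rewrite /= ?linearP //.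
  apply: v_inj; rewrite linearP !qP !linearP.
  by rewrite scalerDr /= [LHS]addrACA.
exists (linear_of pq_lin), (fun z => u z.1 + v z.2) => [x|[e y]] /=.
  by rewrite qP addrC subrK.
have pe : p (u e + v y) = e by rewrite linearD uK pv addr0.
by congr pair => //; apply: v_inj; rewrite qP pe addrC addKr.
Qed.
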